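(* Every randomized online algorithm (without speed augmentation) for minimizing the total flow time $\sum_i (c(i)-r_i)$ has expected competitive ratio at least $\Omega(\sqrt{n})$, where $n$ is the total number of jobs, even when restricted to instances in which all job sizes are $1$ and all node degree bounds are $1$.
   Context: A network has a finite node set $V$; each node $v$ has a degree bound $d_v$. A job $i$ has a source $u_i\in V$, destination $v_i\in V$, size $\ell_i\in\mathbb{N}$ and release time $r_i\in\mathbb{N}$ (all weights equal $1$). Time is slotted. In each time slot $t$ a schedule chooses a multigraph $G_t$ on $V$ in which each node $v$ has degree at most $d_v$, each edge $\{u,v\}$ labelled by a job $i$ with $\{u,v\}=\{u_i,v_i\}$ and $r_i\le t$; each edge labelled $i$ processes one unit of job $i$. Job $i$ completes at time $c(i)$ once it has received $\ell_i$ units of processing; its flow time is $c(i)-r_i$. An online algorithm learns of a job only at its release time. The expected competitive ratio of a randomized online algorithm is the supremum over instances of its expected objective divided by the optimal offline objective. *)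

(* Defs.v *)
From HB Require Import structures.
From mathcomp Require Import all_boot all_order all_algebra.
From mathcomp Require Import all_classical all_reals all_analysis.

Set Implicit Arguments.
Unset Strict Implicit.
Unset Printing Implicit Defensive.

Import Order.TTheory GRing.Theory Num.Theory.

Local Open Scope classical_set_scope.
Local Open Scope ring_scope.

Record network := Network {
  node :> finType;
  degree_bound : node -> nat }.

Record job (N : network) := Job {
  source : N;
  destination : N;
  job_size : nat;
  release : nat }.

Definition job_edge (N : network) (j : job N) : {set N} :=
  [set source j; destination j]%SET.

(* Jobs are named by their position in [jobs], which is ordered by release
   time.  The jobs released up to time t then form a prefix of [jobs], so
   neither the name of a job nor the list of jobs released so far tells anything
   about the jobs released later.  A job joins two distinct nodes, so that
   [job_edge] is an edge. *)
Record instance := Instance {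
  net : network;
  jobs : seq (job net);
  jobs_sorted : sorted (fun i j => (release i <= release j)%N) jobs;
  jobs_loopless : all (fun j => source j != destination j) jobs }.

Definition njobs (I : instance) : nat := size (jobs I).

Definition job_of (I : instance) (i : 'I_(njobs I)) : job (net I) :=
  tnth (in_tuple (jobs I)) i.

(* A finite multigraph whose edges {u, v} are labelled by job names, as the list
   of its labelled edges; the order of the list plays no role. *)
Definition multigraph (V : finType) : Type := seq ({set V} * nat).

Definition degree (V : finType) (G : multigraph V) (v : V) : nat :=
  count (fun e : {set V} * nat => v \in e.1) G.

Definition multiplicity (V : finType) (G : multigraph V) (i : nat) : nat :=
  count (fun e : {set V} * nat => e.2 == i) G.

Definition feasible_slot (I : instance) (t : nat) (G : multigraph (net I)) :
    Prop :=
  (forall e : {set net I} * nat, e \in G ->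
     exists j, [/\ onth (jobs I) e.2 = Some j, e.1 = job_edge j
                 & (release j <= t)%N]) /\
  (forall v, (degree G v <= degree_bound v)%N).

Definition schedule (I : instance) : Type := nat -> multigraph (net I).

Definition feasible (I : instance) (s : schedule I) : Prop :=
  forall t, feasible_slot t (s t).

Section objective.
Variable R : realType.
Local Open Scope ereal_scope.

(* Slot t is the time interval [t, t + 1], so that the slots before time tau are
   0, ..., tau - 1, and a unit job processed in the slot of its release has flow
   time 1.  A job that is never completed has completion time +oo. *)
Definition completion_time (I : instance) (s : schedule I) (i : 'I_(njobs I)) :
    \bar R :=
  ereal_inf [set (tau%:R)%:E | tau in
    [set tau : nat | (release (job_of i) <= tau)%N /\
      (job_size (job_of i) <= \sum_(0 <= t < tau) multiplicity (s t) i)%N]].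

Definition total_flow_time (I : instance) (s : schedule I) : \bar R :=
  \sum_(i < njobs I) (completion_time s i - ((release (job_of i))%:R)%:E).

Definition optimal_flow_time (I : instance) : \bar R :=
  ereal_inf [set total_flow_time s | s in [set s : schedule I | feasible s]].

End objective.

Definition released (I : instance) (t : nat) : seq (job (net I)) :=
  [seq j <- jobs I | (release j <= t)%N].

(* [alg_choice w N t h] is the multigraph chosen in slot t on the network N, with
   random seed w, when h lists the jobs released up to time t.  The earlier
   choices need not be part of the input: they are determined by w, N and h.
   The algorithm may know the network in advance. *)
Record randomized_online_algorithm (d : measure_display)
    (Omega : measurableType d) := RandomizedOnlineAlgorithm {
  alg_choice : Omega -> forall N : network, nat -> seq (job N) -> multigraph N;
  alg_feasible : forall (w : Omega) (I : instance) (t : nat),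
    feasible_slot t (alg_choice w t (released I t));
  alg_measurable : forall (I : instance) (t : nat) (G : multigraph (net I)),
    measurable [set w | alg_choice w t (released I t) = G] }.

Definition alg_schedule (d : measure_display) (Omega : measurableType d)
    (A : randomized_online_algorithm Omega) (I : instance) (w : Omega) :
    schedule I :=
  fun t => alg_choice A w t (released I t).

Section competitive_ratio.
Variables (R : realType) (d : measure_display) (Omega : measurableType d).
Variables (P : probability Omega R) (A : randomized_online_algorithm Omega).
Local Open Scope ereal_scope.

Definition expected_flow_time (I : instance) : \bar R :=
  \int[P]_w total_flow_time R (alg_schedule A I w).

(* The class C is not a [set instance] for universe reasons: instances quantify
   over finTypes. *)
Definition expected_competitive_ratio (C : instance -> Prop) : \bar R :=
  ereal_sup [set x | exists2 I : instance,
    C I & x = expected_flow_time I / optimal_flow_time R I].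

End competitive_ratio.

Definition unit_sizes (I : instance) : Prop :=
  forall i : 'I_(njobs I), job_size (job_of i) = 1%N.

Definition unit_degree_bounds (I : instance) : Prop :=
  forall v : net I, degree_bound v = 1%N.

(* Main.v *)
Require Import Defs.
From HB Require Import structures.
From mathcomp Require Import all_boot all_order all_algebra.
From mathcomp Require Import all_classical all_reals all_analysis.
From mathcomp Require Import measurable_realfun zify ring.

(* The adversary uses a hub joined to two leaves and a sink.  In each of the
   first m slots it releases one job from the hub to each leaf; the hub serves
   only one of them, so by time m the expected backlogs at the two leaves add up
   to at least m, and some leaf b has an expected backlog of at least m / 2.  From
   then on one job between leaf b and the sink arrives in each of n - 2m slots.
   Leaf b can only keep pace with these arrivals, so the backlog at b persists
   and costs (n - 2m) m / 2 in expectation.  Offline, serving leaf b first costs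
   O(n + m^2), and m is about sqrt n. *)

Set Implicit Arguments.
Unset Strict Implicit.
Unset Printing Implicit Defensive.

Import Order.TTheory GRing.Theory Num.Theory.

Local Open Scope classical_set_scope.
Local Open Scope ring_scope.

(** * Flow times and backlogs of unit jobs *)

Section flow_time.
Variable (R : realType).
Local Open Scope ereal_scope.

(** Completion times are infima in the extended reals, possibly [+oo]; this bound and the next
    reduce flow times to inequalities between naturals. *)
Lemma flow_time_ge (I : instance) (s : schedule I) (i : 'I_(njobs I)) (k : nat) :
  (forall tau, (release (job_of i) <= tau)%N ->
     (job_size (job_of i) <= \sum_(0 <= t < tau) multiplicity (s t) i)%N ->
     (release (job_of i) + k <= tau)%N) ->
  (k%:R)%:E <= completion_time R s i - ((release (job_of i))%:R)%:E.
Proof.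
move=> H; rewrite leeBrDr// -EFinD -natrD addnC.
apply: le_ereal_inf_tmp => _ [tau [rel_tau size_tau] <-].
by rewrite lee_fin ler_nat H.
Qed.

Lemma flow_time_le (I : instance) (s : schedule I) (i : 'I_(njobs I)) (k : nat) :
  (job_size (job_of i) <=
     \sum_(0 <= t < release (job_of i) + k) multiplicity (s t) i)%N ->
  completion_time R s i - ((release (job_of i))%:R)%:E <= (k%:R)%:E.
Proof.
move=> H; rewrite leeBlDr// -EFinD -natrD addnC.
apply: ge_ereal_inf; exists ((release (job_of i) + k)%:R%:E) => //.
by exists (release (job_of i) + k)%N => //; split => //; exact: leq_addr.
Qed.

Lemma total_flow_time_ge0 (I : instance) (s : schedule I) :
  0 <= total_flow_time R s.
Proof.
by apply: sume_ge0 => i _; apply: (@flow_time_ge _ _ _ 0) => tau; rewrite addn0.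
Qed.

Lemma optimal_flow_time_ge0 (I : instance) : 0 <= optimal_flow_time R I.
Proof.
by apply: le_ereal_inf_tmp => _ [s _ <-]; exact: total_flow_time_ge0.
Qed.

Definition pending (I : instance) (s : schedule I) (tau : nat)
    (i : 'I_(njobs I)) : bool :=
  (release (job_of i) <= tau)%N &&
  (\sum_(0 <= t < tau) multiplicity (s t) i < job_size (job_of i))%N.

(** Each time at which a job is pending adds one unit to its flow time. Exchanging the sums leaves
    one inequality per job. *)
Lemma total_flow_time_ge_pending (I : instance) (s : schedule I) (a b : nat) :
  ((\sum_(a <= tau < b) \sum_(i < njobs I) pending s tau i)%N%:R)%:E <=
    total_flow_time R s.
Proof.
rewrite exchange_big /= natr_sum -sumEFin; apply: lee_sum => i _.
apply: flow_time_ge => tau rel_tau size_tau.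
rewrite -leq_subRL//.
(* For every candidate completion time [tau], the pending times lie in [[release, tau)], so there
   are at most [tau - release] of them. *)
have pend_lt t : pending s t i -> (release (job_of i) <= t < tau)%N.
  move=> /andP[-> /= lt_size]; rewrite ltnNge; apply/negP => tau_t.
  move: lt_size; rewrite ltnNge => /negP; apply; apply: leq_trans size_tau _.
  by rewrite (big_cat_nat (leq0n tau) tau_t)//= leq_addr.
rewrite -[leqRHS]muln1 -sum_nat_const_nat.
rewrite (eq_bigr (fun t => if pending s t i then 1 else 0)%N); last first.
  by move=> t _; case: pending.
rewrite -big_mkcond /= sum1_count sum1_size -size_filter.
apply: uniq_leq_size; first by rewrite filter_uniq ?iota_uniq.
by move=> t; rewrite mem_filter !mem_index_iota => /andP[/pend_lt].
Qed.

(** Induction on the edge list: an edge carries a single label, and feasibility makes its ends those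
    of the labelling job, so it counts at most once on the left, and then also in the degree. *)
Lemma sum_multiplicity_le_degree (I : instance) (t : nat)
    (G : multigraph (net I)) (v : net I) : feasible_slot t G ->
  (\sum_(i < njobs I | v \in job_edge (job_of i)) multiplicity G i <=
     degree G v)%N.
Proof.
move=> [GP _]; rewrite /multiplicity /degree.
elim: G GP => [|e G IH] GP; first by rewrite big1.
rewrite /= big_split /= leq_add//; last first.
  by apply: IH => e' eG; apply: GP; rewrite inE eG orbT.
have [j [ej e1 _]] := GP e (mem_head _ _).
have elt : (e.2 < njobs I)%N by rewrite /njobs -onthTE ej.
rewrite -big_mkcondr /=.
rewrite (eq_bigl (fun i => (v \in e.1) && (i == Ordinal elt))); last first.
  move=> i; rewrite -val_eqE /= eq_sym; case: eqP => [ie|]; last by rewrite !andbF.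
  rewrite !andbT e1; congr (_ \in job_edge _).
  by apply/tnth_onth; rewrite /= ie.
case: (v \in e.1); last by rewrite big_pred0.
by rewrite big_pred1_eq.
Qed.

(* A unit job at v released by time tau is either pending or has used up one
   unit of the degree of v in some earlier slot. *)
Lemma pending_ge (I : instance) (s : schedule I) (v : net I) (tau : nat) :
  unit_sizes I -> feasible s ->
  (\sum_(i < njobs I) ((v \in job_edge (job_of i)) &&
      (release (job_of i) <= tau)) <=
   \sum_(i < njobs I) pending s tau i + \sum_(0 <= t < tau) degree (s t) v)%N.
Proof.
move=> unitI feas.
apply: (@leq_trans (\sum_(i < njobs I) pending s tau i + \sum_(0 <= t < tau)
    \sum_(i < njobs I | v \in job_edge (job_of i)) multiplicity (s t) i)%N);
  last first.
  by rewrite leq_add2l; apply: leq_sum => t _; exact: sum_multiplicity_le_degree.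
rewrite exchange_big /= [X in (_ <= _ + X)%N]big_mkcond /= -big_split /=.
apply: leq_sum => i _; rewrite /pending unitI.
(* A released job at [v] with zero units received is pending; otherwise its own units contribute at
   least 1. *)
by case: (v \in _) => //=; case: (_ <= tau)%N => //=; case: (\sum_(_ <= _ < _) _)%N.
Qed.

End flow_time.

(** * The two adversarial instances *)

Definition adversary_net : network :=
  @Network (option (option bool)) (fun=> 1%N).
Definition hub : adversary_net := Some None.
Definition leaf (b : bool) : adversary_net := Some (Some b).
Definition sink : adversary_net := None.

(** Jobs [2t] and [2t+1] form the pair released in slot [t < m]. Late jobs start at index [2m] in
    slot [m], one per slot, so releases are monotone in the index. *)
Definition adversary_job (m : nat) (b : bool) (i : nat) : job adversary_net :=
  if (i < m.*2)%N then Job hub (leaf (odd i)) 1 i./2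
  else Job (leaf b) sink 1 (i - m).

Definition adversary_jobs (m n : nat) (b : bool) : seq (job adversary_net) :=
  mkseq (adversary_job m b) n.

Lemma adversary_sorted (m n : nat) (b : bool) :
  sorted (fun i j => (release i <= release j)%N) (adversary_jobs m n b).
Proof.
apply/(sortedP (adversary_job m b 0)) => i; rewrite size_mkseq => i_lt.
rewrite !nth_mkseq//; last by apply: ltnW.
by rewrite /adversary_job; do 2 case: ifP => /=; lia.
Qed.

Lemma adversary_loopless (m n : nat) (b : bool) :
  all (fun j => source j != destination j) (adversary_jobs m n b).
Proof. by rewrite all_map; apply/allP => i _ /=; rewrite /adversary_job; case: ifP. Qed.

Definition adversary (m n : nat) (b : bool) : instance :=
  Instance (adversary_sorted m n b) (adversary_loopless m n b).

Lemma njobs_adversary (m n : nat) (b : bool) : njobs (adversary m n b) = n.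
Proof. exact: size_mkseq. Qed.

Lemma job_of_adversary (m n : nat) (b : bool) (i : 'I_(njobs (adversary m n b))) :
  job_of i = adversary_job m b i.
Proof.
rewrite /job_of (tnth_nth (adversary_job m b 0)) /= nth_mkseq//.
by have := ltn_ord i; rewrite {2}njobs_adversary.
Qed.

Lemma onth_adversary (m n : nat) (b : bool) (i : nat) (j : job adversary_net) :
  onth (adversary_jobs m n b) i = Some j <-> (i < n)%N /\ j = adversary_job m b i.
Proof.
split=> [e|[lt_in ->]].
  have lt_in : (i < n)%N.
    by rewrite -(size_mkseq (adversary_job m b) n) -onthTE e.
  by split=> //; rewrite -(onth_nth j j _ _ e) nth_mkseq.
by rewrite onthE (nth_map (adversary_job m b 0)) ?nth_mkseq ?size_mkseq.
Qed.

Lemma unit_sizes_adversary (m n : nat) (b : bool) : unit_sizes (adversary m n b).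
Proof. by move=> i; rewrite job_of_adversary /adversary_job; case: ifP. Qed.

Lemma in_adversary_job (m : nat) (b : bool) (i : nat) (v : adversary_net) :
  (v \in job_edge (adversary_job m b i)) =
  if (i < m.*2)%N then (v == hub) || (v == leaf (odd i))
  else (v == leaf b) || (v == sink).
Proof. by rewrite /job_edge /adversary_job; case: ifP => _; rewrite !inE. Qed.

Lemma release_adversary_job (m : nat) (b : bool) (i : nat) :
  release (adversary_job m b i) = if (i < m.*2)%N then i./2 else (i - m)%N.
Proof. by rewrite /adversary_job; case: ifP. Qed.

(* In the first m slots the two adversaries look the same. *)
Lemma released_adversary (m n t : nat) (b b' : bool) : (t < m)%N ->
  released (adversary m n b) t = released (adversary m n b') t.
Proof.
move=> t_lt; rewrite /released /= /adversary_jobs /mkseq !filter_map.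
have rel_lt c i : (release (adversary_job m c i) <= t)%N -> (i < m.*2)%N.
  by rewrite release_adversary_job; case: ifP => //; lia.
rewrite (@eq_filter _ _
    (preim (adversary_job m b') (fun j => (release j <= t)%N))); last first.
  by move=> i /=; rewrite !release_adversary_job.
apply/eq_in_map => i; rewrite mem_filter => /andP[/rel_lt i_lt _].
by rewrite /adversary_job i_lt.
Qed.

Lemma sum_odd_eq (b : bool) (m : nat) : (\sum_(0 <= i < m.*2) (odd i == b) = m)%N.
Proof.
elim: m => [|m IH]; first by rewrite big_nil.
by rewrite doubleS !big_nat_recr//= IH odd_double; case: b {IH} => /=; lia.
Qed.

(** One job of each early pair gives [m]; the late jobs [2m, ..., 2m+k-1], released in slots
    [m, ..., m+k-1], give [k]. *)
Lemma leaf_jobs_ge (m n k : nat) (b : bool) : (m.*2 + k <= n)%N ->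
  (m + k <= \sum_(i < njobs (adversary m n b))
     ((leaf b \in job_edge (job_of i)) && (release (job_of i) <= m + k)))%N.
Proof.
move=> le_n.
under eq_bigr do rewrite job_of_adversary.
rewrite -(big_mkord predT (fun i => (leaf b \in job_edge (adversary_job m b i)) &&
  (release (adversary_job m b i) <= m + k)%N : nat)) njobs_adversary.
rewrite (big_cat_nat (leq0n _) le_n)//= (big_cat_nat (leq0n _) (leq_addr k m.*2))//=.
apply: leq_trans (leq_addr _ _); apply: leq_add.
  rewrite -{1}(sum_odd_eq b m) !big_seq; apply: leq_sum => i.
  rewrite mem_index_iota /= => i_lt; rewrite in_adversary_job release_adversary_job.
  rewrite i_lt /= (_ : (i./2 <= m + k)%N) ?andbT; last by lia.
  by case: eqP => // <-; rewrite eqxx ?orbT.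
rewrite -{1}(addKn m.*2 k) -[leqLHS]muln1 -sum_nat_const_nat !big_seq.
apply: leq_sum => i.
rewrite mem_index_iota => /andP[i_ge i_lt].
rewrite in_adversary_job release_adversary_job (leq_gtF i_ge) /= eqxx /=.
by rewrite (_ : (i - m <= m + k)%N) //; lia.
Qed.

(** Let [D] be the degree used at leaf [b] before slot [m]. At each time [m + k] with [k < n - 2m],
    at least [m + k] jobs have arrived there and at most [D + k] units have been served, so [m - D]
    jobs are pending. *)
Lemma adversary_flow_time_ge (R : realType) (m n : nat) (b : bool)
    (s : schedule (adversary m n b)) : feasible s -> (m.*2 <= n)%N ->
  (((n - m.*2) * (m - \sum_(0 <= t < m) degree (s t) (leaf b)))%N%:R%:E <=
    total_flow_time R s)%E.
Proof.
move=> feas le_n; set D := (\sum_(0 <= t < m) _)%N.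
apply: le_trans (total_flow_time_ge_pending _ _ m (m + (n - m.*2))%N).
rewrite lee_fin ler_nat -{1}(addKn m (n - m.*2)%N) -sum_nat_const_nat !big_seq.
apply: leq_sum => tau; rewrite mem_index_iota => /andP[tau_ge tau_lt].
move: tau_lt; rewrite -(subnKC tau_ge); move: (tau - m)%N => k k_lt {tau tau_ge}.
have k_le : (m.*2 + k <= n)%N by lia.
have := leq_trans (leaf_jobs_ge b k_le)
  (@pending_ge (adversary m n b) s (leaf b) (m + k)%N (@unit_sizes_adversary m n b) feas).
rewrite [X in (_ <= _ + X)%N](big_cat_nat (leq0n m) (leq_addr k m))//= -/D.
have : (\sum_(m <= t < m + k) degree (s t) (leaf b) <= k)%N.
  rewrite -[leqRHS](addKn m) -[leqRHS]muln1 -sum_nat_const_nat; apply: leq_sum => t _.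
  exact: (proj2 (feas t)).
clearbody D; move: (\sum_(i < _) _)%N (\sum_(m <= i < _) _)%N => X Y; lia.
Qed.

(* Every job released before time m has an edge at the hub, whose degree is 1. *)
Lemma degree_leaves_le (m n t : nat) (b : bool) (G : multigraph adversary_net) :
  @feasible_slot (adversary m n b) t G -> (t < m)%N ->
  (degree G (leaf false) + degree G (leaf true) <= 1)%N.
Proof.
move=> [GP Gdeg] t_lt; apply: leq_trans (Gdeg hub).
rewrite /degree; elim: G GP {Gdeg} => //= e G IH GP.
have {}IH := IH (fun e' eG => GP e' (mem_behead (s := e :: G) eG)).
have [j [/onth_adversary[_ ->] -> rel_t]] := GP e (mem_head _ _).
rewrite !in_adversary_job; move: rel_t; rewrite release_adversary_job.
by case: ifP => [_ _|]; [case: odd => /=; lia | lia].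
Qed.

(** * The offline schedule and its cost *)

Lemma count_le1 (T : eqType) (P : pred T) (s : seq T) : uniq s ->
  {in s &, forall x y, P x -> P y -> x = y} -> (count P s <= 1)%N.
Proof.
move=> uniq_s inj; rewrite -size_filter.
have := filter_uniq P uniq_s; have := fun x => mem_filter P x s.
case: [seq _ <- _ | _] => [|x [|y r]]//= mem_r; rewrite inE negb_or -andbA => /and3P[xy _ _].
have := mem_r x; rewrite mem_head => /esym/andP[Px xs].
have := mem_r y; rewrite !inE eqxx orbT => /esym/andP[Py ys].
by rewrite (inj x y xs ys Px Py) eqxx in xy.
Qed.

(* The offline schedule serves the jobs at leaf b on arrival, then delays the
   jobs at the other leaf by m slots, where they do not meet the late jobs. *)
Definition offline_slot (m : nat) (b : bool) (i : nat) : nat :=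
  if (i < m.*2)%N then (if odd i == b then i./2 else m + i./2)%N else (i - m)%N.

Definition offline_schedule (m n : nat) (b : bool) : schedule (adversary m n b) :=
  fun t => [seq (job_edge (adversary_job m b i), i) |
              i <- iota 0 n & offline_slot m b i == t].

(** Check each node. The hub serves leaf [b] in slots below [m] and the other leaf in slots [m] to
    [2m-1]; leaf [b] serves hub jobs below [m] and late jobs from [m] on; the other leaf and the
    sink each see one kind of job, in distinct slots. *)
Lemma offline_slot_disjoint (m : nat) (b : bool) (v : adversary_net) (i j : nat) :
  v \in job_edge (adversary_job m b i) -> v \in job_edge (adversary_job m b j) ->
  offline_slot m b i = offline_slot m b j -> i = j.
Proof.
rewrite !in_adversary_job /offline_slot.
case: v => [[[]|]|]; case: b; case: ifP => ?; case: ifP => ?.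
all: by case oi: (odd i); case oj: (odd j) => //= _ _; lia.
Qed.

Lemma release_le_offline_slot (m : nat) (b : bool) (i : nat) :
  (release (adversary_job m b i) <= offline_slot m b i)%N.
Proof.
rewrite release_adversary_job /offline_slot.
by case: ifP => // _; case: ifP => // _; exact: leq_addl.
Qed.

Lemma offline_feasible (m n : nat) (b : bool) : feasible (offline_schedule m n b).
Proof.
move=> t; split => [_ /mapP[i + ->]|v].
  rewrite mem_filter mem_iota add0n => /and3P[/eqP slot_t _ i_lt].
  exists (adversary_job m b i); split => //; first exact/onth_adversary.
  by rewrite -slot_t release_le_offline_slot.
rewrite /degree count_map; apply: count_le1.
  by rewrite filter_uniq ?iota_uniq.
move=> i j; rewrite !mem_filter => /andP[/eqP it _] /andP[/eqP jt _] /= vi vj.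
by apply: offline_slot_disjoint vi vj _; rewrite it jt.
Qed.

Lemma offline_flow_time_le (R : realType) (m n : nat) (b : bool) :
  (m.*2 <= n)%N ->
  (total_flow_time R (offline_schedule m n b) <= (n + m.*2 * m)%:R%:E)%E.
Proof.
move=> le_n.
(* Every job is charged 1, and each of the [2m] early jobs a further [m] for its possible delay. *)
have -> : (n + m.*2 * m = \sum_(0 <= i < n) (1 + (i < m.*2) * m))%N.
  rewrite big_split /= sum_nat_const_nat subn0 muln1; congr addn.
  rewrite (big_cat_nat (leq0n _) le_n)//=.
  rewrite (@eq_big_nat _ _ _ 0 m.*2 _ (fun=> m)); last first.
    by move=> i /= ->; rewrite mul1n.
  rewrite (@eq_big_nat _ _ _ m.*2 n _ (fun=> 0%N)); last first.
    by move=> i /andP[/leq_gtF ->].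
  by rewrite !sum_nat_const_nat subn0 muln0 addn0.
apply: (@le_trans _ _ (\sum_(i < njobs (adversary m n b))
    (1 + (i < m.*2) * m)%N%:R%:E)%E); last first.
  rewrite sumEFin -natr_sum.
  by rewrite -(big_mkord predT (fun i => 1 + (i < m.*2) * m)%N) njobs_adversary.
apply: lee_sum => i _; have i_lt := ltn_ord i; rewrite {2}njobs_adversary in i_lt.
have rel_le : (release (job_of i) <= offline_slot m b i)%N.
  by rewrite job_of_adversary release_le_offline_slot.
apply: le_trans.
  apply: (@flow_time_le R _ _ i ((offline_slot m b i).+1 - release (job_of i))).
  rewrite subnKC ?leqW// unit_sizes_adversary big_nat_recr//=.
  apply: leq_trans (leq_addl _ _); rewrite -has_count has_map.
  by apply/hasP; exists (i : nat) => //=; rewrite mem_filter eqxx mem_iota.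
rewrite lee_fin ler_nat job_of_adversary release_adversary_job /offline_slot.
by case: ifP => ? /=; [case: ifP => ?; lia | lia].
Qed.

Lemma optimal_flow_time_adversary_le (R : realType) (m n : nat) (b : bool) :
  (m.*2 <= n)%N ->
  (optimal_flow_time R (adversary m n b) <= (n + m.*2 * m)%:R%:E)%E.
Proof.
move=> le_n; apply: ge_ereal_inf; exists (total_flow_time R (offline_schedule m n b)).
  by exists (offline_schedule m n b) => //; exact: offline_feasible.
exact: offline_flow_time_le.
Qed.

(** * Expected cost of a randomized algorithm *)

Section expectation.
Context (R : realType) (d : measure_display) (Omega : measurableType d).
Variables (P : probability Omega R) (A : randomized_online_algorithm Omega).

(* Unlike [ge0_le_integral], this needs no measurability, because the integral
   of a nonnegative function is a supremum over the simple functions below it. *)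
Lemma ge0_le_integralT (f g : Omega -> \bar R) :
  (forall w, 0 <= f w)%E -> (forall w, f w <= g w)%E ->
  (\int[P]_w f w <= \int[P]_w g w)%E.
Proof.
move=> f0 fg; have g0 w : (0 <= g w)%E := le_trans (f0 w) (fg w).
rewrite !ge0_integralTE//; apply: ereal_sup_le => _ [h hf <-].
by exists h => // w; exact: le_trans (hf w) (fg w).
Qed.

(** There are countably many multigraphs on a finite node set, so every preimage is a countable
    union of events that are measurable or empty. *)
Lemma measurable_alg_schedule (I : instance) (t : nat)
    (f : multigraph (net I) -> R) :
  measurable_fun setT (fun w => f (alg_schedule A I w t)).
Proof.
move=> _ B mB; rewrite setTI.
have -> : (fun w => f (alg_schedule A I w t)) @^-1` B =
    \bigcup_G [set w | alg_schedule A I w t = G /\ B (f G)].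
  apply/seteqP; split=> [w Bw|w [G _ [<-]]//].
  by exists (alg_schedule A I w t).
apply: countable_bigcupT_measurable => [|G].
  exact: (countableP (T := seq ({set net I} * nat))).
have [BG|nBG] := pselect (B (f G)).
  rewrite (_ : mkset _ = [set w | alg_choice A w t (released I t) = G]).
    exact: alg_measurable.
  by apply/seteqP; split=> [w []|w].
rewrite (_ : mkset _ = set0); first exact: measurable0.
by apply/seteqP; split=> [w []|w].
Qed.

Lemma alg_schedule_feasible (I : instance) (w : Omega) :
  feasible (alg_schedule A I w).
Proof. by move=> t; exact: alg_feasible. Qed.

Lemma adversary_expected_flow_time_ge (m n : nat) : (m.*2 <= n)%N ->
  (((n - m.*2) * m)%N%:R%:E <=
    expected_flow_time P A (adversary m n false) +
    expected_flow_time P A (adversary m n true))%E.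
Proof.
move=> le_n.
pose D b w t := degree (alg_schedule A (adversary m n b) w t) (leaf b).
have D1 b w t : (D b w t <= 1)%N.
  exact: (proj2 (@alg_schedule_feasible (adversary m n b) w t)).
have Dm b w : (\sum_(0 <= t < m) D b w t <= m)%N.
  rewrite -[leqRHS]muln1 -{2}(subn0 m) -sum_nat_const_nat.
  by apply: leq_sum => t _.
have D2 w : (\sum_(0 <= t < m) D false w t + \sum_(0 <= t < m) D true w t <= m)%N.
  rewrite -[leqRHS]muln1 -{3}(subn0 m) -sum_nat_const_nat -big_split /=.
  rewrite big_nat [leqRHS]big_nat; apply: leq_sum => t /andP[_ t_lt].
  (* For each seed the two runs agree before slot [m], so both leaf degrees are read off one
     multigraph, where the hub bounds their sum by 1. *)
  rewrite /D /alg_schedule (released_adversary n false true t_lt).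
  exact: (degree_leaves_le (alg_feasible A w (adversary m n true) t) t_lt).
(* A measurable lower bound for the flow time: additivity of the integral is applied to [g], and
   only monotonicity to the flow time. *)
pose g b w : R :=
  (n - m.*2)%:R * (m%:R - \sum_(0 <= t < m) (D b w t)%:R).
have gE b w : g b w = ((n - m.*2) * (m - \sum_(0 <= t < m) D b w t))%N%:R.
  by rewrite /g -natr_sum -natrB// -natrM.
have g0 b w : (0 <= (g b w)%:E)%E by rewrite gE lee_fin.
have mg b : measurable_fun setT (EFin \o g b).
  apply/measurable_EFinP; apply: measurable_funM => //; apply: measurable_funB => //.
  apply: measurable_sum => t.
  exact: (@measurable_alg_schedule (adversary m n b) t
    (fun G => (degree G (leaf b))%:R)).
have gF b : (\int[P]_w (g b w)%:E <= expected_flow_time P A (adversary m n b))%E.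
  apply: ge0_le_integralT => // w; rewrite gE.
  apply: adversary_flow_time_ge => //; exact: alg_schedule_feasible.
apply: le_trans (leeD (gF false) (gF true)).
rewrite -ge0_integralD//; [|exact: mg|exact: mg].
apply: (@le_trans _ _ (\int[P]_w (cst ((n - m.*2) * m)%N%:R%:E w))%E).
  by rewrite integral_cst//= [X in (_ * X)%E]probability_setT mule1.
apply: ge0_le_integralT => w; rewrite ?lee_fin//.
(* The two backlogs add up to at least [2m - m = m] for every seed. *)
rewrite !gE -natrD ler_nat -mulnDr leq_mul2l.
by have := D2 w; lia.
Qed.

End expectation.

(** * The competitive ratio *)

(** Inversion is antitone on the nonnegative extended reals, zero included, so an upper bound on the
    denominator suffices. *)
Lemma lee_div2 (R : realType) (x y : \bar R) (a b : R) :
  (0 < a)%R -> (0 < b)%R -> (a%:E <= x)%E -> (0 <= y <= b%:E)%E ->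
  ((a / b)%:E <= x / y)%E.
Proof.
move=> a0 b0 ax /andP[y0 yb].
have bV : (b^-1%:E = (b%:E)^-1 :> \bar R)%E by rewrite inver (gt_eqF b0).
rewrite EFinM lee_pmul//; [exact: ltW|by rewrite lee_fin invr_ge0 ltW|].
by rewrite bV inve_ple ?inveK// inE ?inve_ge0// lee_fin ltW.
Qed.

Lemma sqrtn_bounds (n : nat) : exists m, (m * m <= n < m.+1 * m.+1)%N.
Proof.
elim: n => [|n [m /andP[m_le n_lt]]]; first by exists 0%N.
have [lt|ge] := ltnP n.+1 (m.+1 * m.+1); first by exists m; rewrite lt leqW.
by exists m.+1; rewrite ge /=; nia.
Qed.

Theorem theorem4 (R : realType) :
  exists2 c : R, 0 < c &
  exists n0 : nat,
  forall (d : measure_display) (Omega : measurableType d)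
    (P : probability Omega R) (A : randomized_online_algorithm Omega) (n : nat),
  (n0 <= n)%N ->
  ((c * Num.sqrt n%:R)%:E <=
   expected_competitive_ratio P A
     (fun I => [/\ njobs I = n, unit_sizes I & unit_degree_bounds I]))%E.
Proof.
(* The cost is at least [mn/4] and the optimum at most [3n], giving the ratio [m/12]; finally
   [sqrt n <= 2m]. *)
exists 24^-1; first by rewrite invr_gt0.
(* From [n >= 16] follows [m >= 4], hence [4m <= m * m <= n] and [n - 2m >= n/2]. *)
exists 16%N => d Omega P A n n_ge.
have [m /andP[m_le n_lt]] := sqrtn_bounds n.
have m_ge : (4 <= m)%N by rewrite leqNgt; apply/negP => ?; nia.
have le_n : (m.*2 <= n)%N by nia.
(* Averaging: were both expected costs below half the bound, so would be their sum. The leaf [b]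
   depends on the algorithm. *)
have [b Fb] : exists b, ((((n - m.*2) * m)%N%:R / 2)%:E <=
    expected_flow_time P A (adversary m n b))%E.
  apply: contrapT => /forallNP F_lt.
  have := adversary_expected_flow_time_ge P A le_n; apply/negP; rewrite -ltNge.
  rewrite [_%:R]splitr EFinD; apply: lteD; rewrite ltNge; apply/negP; exact: F_lt.
apply: (@le_trans _ _ (expected_flow_time P A (adversary m n b) /
    optimal_flow_time R (adversary m n b))%E); last first.
  apply: ereal_sup_ubound; exists (adversary m n b) => //; split => //.
  - exact: njobs_adversary.
  - exact: unit_sizes_adversary.
apply: le_trans (lee_div2 (b := (3 * n)%:R) _ _ Fb _); last 3 first.
- by rewrite divr_gt0// ltr0n; nia.
- by rewrite ltr0n; nia.
- rewrite optimal_flow_time_ge0 /=.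
  apply: le_trans (optimal_flow_time_adversary_le _ _ le_n) _.
  by rewrite lee_fin ler_nat; nia.
have n0 : 0 < n%:R :> R by rewrite ltr0n; nia.
have sqrt_le : Num.sqrt n%:R <= (2 * m)%:R :> R.
  rewrite -[leRHS]ger0_norm// -sqrtr_sqr ler_sqrt ?sqr_ge0//.
  by rewrite -natrX ler_nat; nia.
rewrite lee_fin ler_pdivlMr ?ltr0n; last by nia.
apply: (@le_trans _ _ (24^-1 * (2 * m)%:R * (3 * n)%:R)).
  by rewrite ler_pM2r ?ltr0n ?ler_pM2l ?invr_gt0//; nia.
have -> : 24^-1 * (2 * m)%:R * (3 * n)%:R = (m * n)%:R / 4 :> R.
  by rewrite !natrM; field.
have -> : ((n - m.*2) * m)%N%:R / 2 = (2 * ((n - m.*2) * m))%N%:R / 4 :> R.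
  by rewrite [in RHS]natrM; field.
(* What remains is [m * n <= 2 * (n - 2m) * m], that is, [4m <= n]. *)
by rewrite ler_pM2r ?invr_gt0// ler_nat; nia.
Qed.
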